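(* Let $w$ be a Lévy white noise on $\mathbb{R}^d$ with Lévy exponent $f$, associated sets $I_0, I_\infty$ and Blumenthal-Getoor indices $\beta_0$ and $\beta_\infty$. Let $0<p<\beta_0$, and let $\tilde{\beta}_0 \in I_0$ and $\tilde{\beta}_\infty \in I_\infty$ be such that $p<\tilde{\beta}_0$ and $p<\tilde{\beta}_\infty$. Then there exists a constant $C>0$ such that, for every $\varphi \in \mathcal{S}(\mathbb{R}^d)$, $$\mathbb{E}\left[ |\langle w,\varphi\rangle|^p \right] \leq C\left( \|\varphi\|_{\tilde{\beta}_0}^p + \|\varphi\|_{\tilde{\beta}_\infty}^p \right).$$ Moreover, the result is still valid for $p=\tilde{\beta}_0=\tilde{\beta}_\infty=2$ if $\beta_0 = 2 \in I_0$.
   Context: $\mathcal{S}(\mathbb{R}^d)$ is the Schwartz space of (real-valued) rapidly decaying smooth functions, $\mathcal{S}'(\mathbb{R}^d)$ its topological dual, endowed with the cylindrical $\sigma$-field $\mathcal{B}_c(\mathcal{S}'(\mathbb{R}^d))$, generated by the sets $\{u : (\langle u,\varphi_1\rangle,\ldots,\langle u,\varphi_n\rangle)\in B\}$ with $n \geq 1$, $\varphi_i\in\mathcal{S}(\mathbb{R}^d)$, $B\subseteq\mathbb{R}^n$ Borel. A generalized random process is a measurable map from a probability space $\Omega$ to $(\mathcal{S}'(\mathbb{R}^d),\mathcal{B}_c(\mathcal{S}'(\mathbb{R}^d)))$. A Lévy exponent is a function $f:\mathbb{R}\to\mathbb{C}$ that is the continuous log-characteristic function of an infinitely divisible real random variable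 $X$ (i.e. $\mathbb{E}[e^{\mathrm{i}\xi X}]=e^{f(\xi)}$, $f$ continuous, $f(0)=0$); it satisfies the Schwartz condition if $\mathbb{E}[|X|^\epsilon]<\infty$ for some $\epsilon>0$. A Lévy white noise with Lévy exponent $f$ (satisfying the Schwartz condition) is a generalized random process $w$ with characteristic functional $\mathbb{E}[e^{\mathrm{i}\langle w,\varphi\rangle}]=\exp\left(\int_{\mathbb{R}^d} f(\varphi(\boldsymbol{x}))\,\mathrm{d}\boldsymbol{x}\right)$ for all $\varphi\in\mathcal{S}(\mathbb{R}^d)$. For a Lévy exponent $f$, set $I_0=\{p\in[0,2]: \limsup_{|\xi|\to 0}|f(\xi)|/|\xi|^p<\infty\}$ and $I_\infty=\{p\in[0,2]: \limsup_{|\xi|\to\infty}|f(\xi)|/|\xi|^p<\infty\}$. The Blumenthal-Getoor indices are $\beta_0=\sup I_0$ and $\beta_\infty=\inf I_\infty$. For $0<\beta<\infty$, $\|\varphi\|_\beta=\left(\int_{\mathbb{R}^d}|\varphi(\boldsymbol{x})|^\beta\,\mathrm{d}\boldsymbol{x}\right)^{1/\beta}$. *)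

(* Defs.v *)
From HB Require Import structures.
From mathcomp Require Import all_boot all_order all_algebra.
From mathcomp Require Import all_classical all_reals all_analysis.
From mathcomp Require Import complex.

Set Implicit Arguments.
Unset Strict Implicit.
Unset Printing Implicit Defensive.

Import Order.TTheory GRing.Theory Num.Theory.
Import numFieldNormedType.Exports.

Local Open Scope classical_set_scope.
Local Open Scope ring_scope.

Section rV_measurable.
Context {R : realType} (n : nat).

Let coors : 'I_n -> 'rV[R]_n -> R := fun i x => x ord0 i.

Let rV_set0 : g_sigma_preimage coors set0.
Proof. exact: sigma_algebra0. Qed.

Let rV_setC A : g_sigma_preimage coors A -> g_sigma_preimage coors (~` A).
Proof. exact: sigma_algebraC. Qed.

Let rV_bigcup (F : (set 'rV[R]_n)^nat) :
  (forall i, g_sigma_preimage coors (F i)) ->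
  g_sigma_preimage coors (\bigcup_i (F i)).
Proof. exact: sigma_algebra_bigcup. Qed.

(* The sigma-algebra generated by the coordinates is the Borel one. *)
HB.instance Definition _ := @isMeasurable.Build default_measure_display
  'rV[R]_n (g_sigma_preimage coors) rV_set0 rV_setC rV_bigcup.

End rV_measurable.

Section rV_measurable_fun.
Context {R : realType} (n : nat).

Lemma measurable_coord (i : 'I_n) :
  measurable_fun [set: 'rV[R]_n] (fun x : 'rV[R]_n => x ord0 i).
Proof.
move=> _ Y mY; rewrite setTI; apply: sub_sigma_algebra => /=.
rewrite -bigcup_seq/=; exists i => /=; first by rewrite mem_index_enum.
by exists Y => //; rewrite setTI.
Qed.

Lemma measurable_fun_rVP d (T : measurableType d) (f : T -> 'rV[R]_n) :
  (forall i, measurable_fun setT (fun t => f t ord0 i)) -> measurable_fun setT f.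
Proof.
move=> mf _ A mA; rewrite setTI.
suff H : @measurable _ 'rV[R]_n `<=` [set B | measurable (f @^-1` B)].
  exact: H mA.
apply: smallest_sub.
  split => //=.
  - by rewrite preimage_set0.
  - by move=> B mB; rewrite setTD preimage_setC; exact: measurableC.
  - by move=> F mF; rewrite preimage_bigcup; exact: bigcup_measurable.
rewrite -bigcup_seq/=; apply: bigcup_sub => i _ _ [B mB <-] /=.
by have := mf i measurableT B mB; rewrite !setTI.
Qed.

End rV_measurable_fun.

Section rV_cons.
Context {R : realType} (n : nat).

Definition rV_cons (p : R * 'rV[R]_n) : 'rV[R]_n.+1 :=
  \row_i (if unlift ord0 i is Some j then p.2 ord0 j else p.1).

Definition rV_uncons (x : 'rV[R]_n.+1) : R * 'rV[R]_n :=
  (x ord0 ord0, \row_i x ord0 (lift ord0 i)).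

Lemma rV_consK : cancel rV_cons rV_uncons.
Proof.
move=> [a x]; congr pair => /=; first by rewrite mxE unlift_none.
by apply/rowP => i; rewrite !mxE liftK.
Qed.

Lemma rV_unconsK : cancel rV_uncons rV_cons.
Proof.
move=> x; apply/rowP => i; rewrite mxE.
by case: unliftP => [j|] ->; rewrite ?mxE.
Qed.

Lemma measurable_rV_cons : measurable_fun setT rV_cons.
Proof.
apply: measurable_fun_rVP => i; under eq_fun do rewrite mxE.
case: (unlift ord0 i) => [j|]; last exact: measurable_fst.
by apply: (measurableT_comp (measurable_coord j)); exact: measurable_snd.
Qed.

Lemma measurable_rV_uncons : measurable_fun setT rV_uncons.
Proof.
apply/measurable_fun_pair => /=; first exact: measurable_coord.
apply: measurable_fun_rVP => i.
rewrite (_ : (fun t => _) = fun x : 'rV[R]_n.+1 => x ord0 (lift ord0 i)).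
  exact: measurable_coord.
by apply/funext => t; rewrite mxE.
Qed.

End rV_cons.

Section lebesgue_rV_succ.
Context {R : realType} (n : nat).
Variable m : {sigma_finite_measure set 'rV[R]_n -> \bar R}.

Definition lebesgue_rV_succ : set 'rV[R]_n.+1 -> \bar R :=
  pushforward (@lebesgue_measure R \x m)%E (@rV_cons R n).

HB.instance Definition _ := Measure.copy lebesgue_rV_succ
  (measure_function_pushforward__canonical__measure_function_Measure
     (@lebesgue_measure R \x m)%E (@measurable_rV_cons R n)).

Let lebesgue_rV_succ_sigma_finite : sigma_finite setT lebesgue_rV_succ.
Proof.
have /sigma_finiteP[F [FT ndF Foo]] := sigma_finiteT (@lebesgue_measure R).
have /sigma_finiteP[G [GT ndG Goo]] := sigma_finiteT m.
exists (fun i => @rV_uncons R n @^-1` (F i `*` G i)).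
  rewrite -preimage_bigcup (_ : \bigcup_i _ = setT) ?preimage_setT//.
  rewrite -subTset => -[x y] _.
  have [i _ Fix] : (\bigcup_i F i) x by rewrite -FT.
  have [j _ Gjy] : (\bigcup_i G i) y by rewrite -GT.
  exists (maxn i j) => //; split => /=.
  - by move: x Fix; exact/subsetPset/ndF/leq_maxl.
  - by move: y Gjy; exact/subsetPset/ndG/leq_maxr.
move=> i; have [mFi Fioo] := Foo i; have [mGi Gioo] := Goo i; split.
  rewrite -[X in measurable X]setTI; apply: measurable_rV_uncons => //.
  exact: measurableX.
rewrite /lebesgue_rV_succ /pushforward -comp_preimage.
rewrite (_ : _ \o _ = id); last by apply/funext => x; exact: rV_consK.
rewrite preimage_id product_measure1E//.
by rewrite lte_mul_pinfty// ge0_fin_numE.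
Qed.

HB.instance Definition _ := Measure_isSigmaFinite.Build _ _ _
  lebesgue_rV_succ lebesgue_rV_succ_sigma_finite.

End lebesgue_rV_succ.

Fixpoint lebesgue_rV (R : realType) (n : nat) :
    {sigma_finite_measure set 'rV[R]_n -> \bar R} :=
  if n is m.+1 then lebesgue_rV_succ (lebesgue_rV R m) else \d_(0 : 'rV[R]_0).

Section schwartz.
Context {R : realType} {d : nat}.
Implicit Types (f g : 'rV[R]_d -> R) (s : seq 'I_d).

(* [s] lists the directions of the successive differentiations. *)
Definition partials s f : 'rV[R]_d -> R :=
  foldr (fun i g => 'D_(delta_mx ord0 i) g) f s.

Definition smooth f := forall s x, differentiable (partials s f) x.

(* [`|x|] is the max norm on R^d; together these seminorms generate the same
   topology as the suprema of [|x^alpha * D^beta f|]. *)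
Definition schwartz_seminorm (k : nat) s f : \bar R :=
  ereal_sup (range (fun x => ((1 + `|x|) ^+ k * `|partials s f x|)%:E)).

Definition schwartz_pred : {pred 'rV[R]_d -> R} :=
  mem [set f | smooth f /\ forall k s, (schwartz_seminorm k s f < +oo)%E].

Lemma partialsD s f g : smooth f -> smooth g ->
  partials s (f + g) = partials s f + partials s g.
Proof.
move=> sf sg; elim: s => //= i s ->; apply/funext => x.
by rewrite deriveD//; exact: diff_derivable.
Qed.

Lemma partialsZ s (a : R) f : smooth f ->
  partials s (a \*: f) = a \*: partials s f.
Proof.
move=> sf; elim: s => //= i s ->; apply/funext => x.
by rewrite deriveZ//; exact: diff_derivable.
Qed.

Lemma schwartz_seminorm_ge k s f x :
  (((1 + `|x|) ^+ k * `|partials s f x|)%:E <= schwartz_seminorm k s f)%E.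
Proof. by apply: ereal_sup_ubound; exists x. Qed.

Lemma schwartz_seminormD k s f g : smooth f -> smooth g ->
  (schwartz_seminorm k s (f + g)%R <=
   schwartz_seminorm k s f + schwartz_seminorm k s g)%E.
Proof.
move=> sf sg; apply: ge_ereal_sup => _ [x _ <-].
apply: le_trans (leeD (schwartz_seminorm_ge k s f x)
                      (schwartz_seminorm_ge k s g x)).
rewrite lee_fin partialsD// -mulrDr ler_wpM2l ?exprn_ge0 ?addr_ge0//.
exact: ler_normD.
Qed.

Lemma schwartz_seminormZ k s (a : R) f : smooth f ->
  (schwartz_seminorm k s (a \*: f)%R <= `|a|%:E * schwartz_seminorm k s f)%E.
Proof.
move=> sf; apply: ge_ereal_sup => _ [x _ <-].
apply: le_trans (lee_wpmul2l _ (schwartz_seminorm_ge k s f x)); last first.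
  by rewrite lee_fin.
by rewrite -EFinM lee_fin partialsZ//= normrM mulrCA.
Qed.

Lemma partials0 s : partials s (cst 0) = cst 0.
Proof.
by elim: s => //= i s ->; apply/funext => x; rewrite derive_cst.
Qed.

Lemma schwartz_seminorm0 k s : schwartz_seminorm k s (cst 0) = 0%E.
Proof.
rewrite /schwartz_seminorm partials0 (_ : (fun _ => _) = cst 0%E).
  by rewrite set_cst ifF ?ereal_sup1//; apply/negbTE/set0P; exists 0.
by apply/funext => x; rewrite normr0 mulr0.
Qed.

Lemma schwartz_submod_closed : submod_closed schwartz_pred.
Proof.
split=> [|a f g]; rewrite !inE /=.
  split=> [s x|k s]; first by rewrite partials0; exact: differentiable_cst.
  by rewrite schwartz_seminorm0.
move=> [sf nf] [sg ng].
have saf : smooth (a \*: f).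
  by move=> s x; rewrite partialsZ//; exact: differentiableZ.
split=> [s x|k s]; first by rewrite partialsD//; exact: differentiableD.
apply: le_lt_trans (schwartz_seminormD k s saf sg) _.
rewrite lte_add_pinfty//; apply: le_lt_trans (schwartz_seminormZ k s a sf) _.
by rewrite lte_mul_pinfty// lee_fin.
Qed.

HB.instance Definition _ := GRing.isSubmodClosed.Build _ _ schwartz_pred
  schwartz_submod_closed.

End schwartz.

Record schwartz (R : realType) (d : nat) := Schwartz {
  schwartz_fun :> 'rV[R]_d -> R ;
  schwartz_funP : schwartz_fun \in schwartz_pred }.

Section schwartz_lmod.
Context (R : realType) (d : nat).

HB.instance Definition _ := [isSub for @schwartz_fun R d].
HB.instance Definition _ := [Choice of schwartz R d by <:].
HB.instance Definition _ := [SubChoice_isSubLmodule of schwartz R d by <:].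

End schwartz_lmod.

Section schwartz_topology.
Context {R : realType} {d : nat}.
Implicit Types (phi psi : schwartz R d) (s : seq (nat * seq 'I_d)).

Lemma schwartz_smooth phi : smooth phi.
Proof. by have := schwartz_funP phi; rewrite inE => -[]. Qed.

(* Since [s] is a finite family of seminorms, these balls form a basis of
   neighbourhoods for the usual Frechet topology. *)
Definition schwartz_ball phi s (e : R) : set (schwartz R d) :=
  [set psi | forall q, q \in s ->
    (schwartz_seminorm q.1 q.2 (psi - phi : schwartz R d)%R < e%:E)%E].

Definition schwartz_nbhs phi : set_system (schwartz R d) :=
  [set A | exists s, exists2 e : R, 0 < e & schwartz_ball phi s e `<=` A].

HB.instance Definition _ := hasNbhs.Build (schwartz R d) schwartz_nbhs.

Let schwartz_ball_center phi s (e : R) : 0 < e -> schwartz_ball phi s e phi.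
Proof.
move=> e0 q _; rewrite subrr (_ : schwartz_fun 0 = cst 0)//.
by rewrite schwartz_seminorm0 lte_fin.
Qed.

Let schwartz_nbhs_filter phi : ProperFilter (nbhs phi).
Proof.
split.
  move=> [s [e e0 sA]].
  by have : set0 phi := sA _ (@schwartz_ball_center phi s e e0).
split.
- by exists [::]; exists 1.
- move=> A B [s [e e0 sA]] [t [f f0 tB]].
  exists (s ++ t); exists (Num.min e f); first by rewrite lt_min e0.
  move=> psi psiE; split.
  + apply: sA => q qs; apply: lt_le_trans (psiE q _) _.
      by rewrite mem_cat qs.
    by rewrite lee_fin ge_min lexx.
  + apply: tB => q qt; apply: lt_le_trans (psiE q _) _.
      by rewrite mem_cat qt orbT.
    by rewrite lee_fin ge_min lexx orbT.
- by move=> A B AB [s [e e0 sA]]; exists s, e => //; exact: subset_trans AB.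
Qed.

Let schwartz_nbhs_singleton phi (A : set (schwartz R d)) : nbhs phi A -> A phi.
Proof. by move=> [s [e e0 sA]]; exact/sA/schwartz_ball_center. Qed.

Let schwartz_nbhs_nbhs phi (A : set (schwartz R d)) :
  nbhs phi A -> nbhs phi (nbhs^~ A).
Proof.
move=> [s [e e0 sA]]; exists s, (e / 2); first exact: divr_gt0.
move=> psi psiphi; exists s, (e / 2); first exact: divr_gt0.
move=> chi chipsi; apply: sA => q qs.
have -> : schwartz_fun (chi - phi) =
    (chi - psi : schwartz R d) + (psi - phi : schwartz R d) :> ('rV[R]_d -> R).
  by apply/funext => x /=; rewrite -[LHS]/(chi x - phi x)
    -[RHS]/((chi x - psi x) + (psi x - phi x)) addrA subrK.
apply: le_lt_trans (schwartz_seminormD _ _ _ _) _; try exact: schwartz_smooth.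
by rewrite [e]splitr EFinD lteD//; [exact: chipsi|exact: psiphi].
Qed.

HB.instance Definition _ := Nbhs_isNbhsTopological.Build (schwartz R d)
  schwartz_nbhs_filter schwartz_nbhs_singleton schwartz_nbhs_nbhs.

End schwartz_topology.

Record tempered (R : realType) (d : nat) := Tempered {
  tempered_fun :> {linear schwartz R d -> R^o} ;
  tempered_continuous : continuous (tempered_fun : schwartz R d -> R) }.

Section tempered_measurable.
Context (R : realType) (d : nat).

Let tempered0_continuous :
  continuous (([the {linear schwartz R d -> R^o} of \0]) : schwartz R d -> R).
Proof. exact: cst_continuous. Qed.

HB.instance Definition _ := gen_eqMixin (tempered R d).
HB.instance Definition _ := gen_choiceMixin (tempered R d).
HB.instance Definition _ := isPointed.Build (tempered R d)
  (Tempered tempered0_continuous).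

Definition cylinder : set_system (tempered R d) :=
  [set A | exists n (phi : n.+1.-tuple (schwartz R d))
             (B : set (n.+1.-tuple R)),
    measurable B /\ A = [set u : tempered R d | B [tuple of map u phi]]].

Let cylindrical_set0 : <<s cylinder >> set0.
Proof. exact: sigma_algebra0. Qed.

Let cylindrical_setC A : <<s cylinder >> A -> <<s cylinder >> (~` A).
Proof. by move=> sA; rewrite -setTD; exact: sigma_algebraCD. Qed.

Let cylindrical_bigcup (F : (set (tempered R d))^nat) :
  (forall i, <<s cylinder >> (F i)) -> <<s cylinder >> (\bigcup_i (F i)).
Proof. exact: sigma_algebra_bigcup. Qed.

HB.instance Definition _ := @isMeasurable.Build default_measure_display
  (tempered R d) <<s cylinder >> cylindrical_set0 cylindrical_setC
  cylindrical_bigcup.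

End tempered_measurable.

Section complex_integral.
Context {R : realType}.

Definition cexp (z : R[i]) : R[i] :=
  let: (a +i* b)%C := z in (expR a * cos b +i* (expR a * sin b))%C.

Definition cintegral d (T : measurableType d) (mu : {measure set T -> \bar R})
    (F : T -> R[i]) : R[i] :=
  (\int[mu]_x complex.Re (F x) +i* \int[mu]_x complex.Im (F x))%C.

End complex_integral.

Section levy.
Context {R : realType}.

(* [convolution_power nu n] is the law of a sum of [n] independent random
   variables of law [nu]. *)
Fixpoint convolution_power (nu : probability (measurableTypeR R) R) (n : nat) :
    set R -> \bar R :=
  if n is m.+1 then
    fun A => (\int[nu]_x convolution_power nu m [set y | A (x + y)%R])%E
  else \d_(0 : R).

Definition infinitely_divisible (mu : probability (measurableTypeR R) R) :=
  forall n, (0 < n)%N -> exists nu : probability (measurableTypeR R) R,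
    forall A : set (measurableTypeR R), measurable A ->
      mu A = convolution_power nu n A.

(* [mu] is the law of the infinitely divisible random variable. Continuity of
   [f] is that of its real and imaginary parts, as the concrete type [R[i]]
   carries no topology in the library. *)
Definition levy_exponent_of (mu : probability (measurableTypeR R) R)
    (f : R -> R[i]) :=
  [/\ infinitely_divisible mu,
      continuous (fun xi => complex.Re (f xi)),
      continuous (fun xi => complex.Im (f xi)),
      f 0 = 0 &
      forall xi : R,
        cintegral mu (fun x : R => cexp ('i * (xi * x)%:C)%C) = cexp (f xi)].

(* A moment condition on the law [mu] of the infinitely divisible random
   variable, not to be confused with membership in the Schwartz space. *)
Definition schwartz_condition (mu : probability (measurableTypeR R) R) :=
  exists2 eps : R, 0 < eps & (\int[mu]_x ((`|x| `^ eps)%R)%:E < +oo)%E.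

Definition levy_exponent_schwartz (f : R -> R[i]) :=
  exists2 mu : probability (measurableTypeR R) R,
    levy_exponent_of mu f & schwartz_condition mu.

Definition levy_white_noise (d : nat) dO (Omega : measurableType dO)
    (P : probability Omega R) (f : R -> R[i])
    (w : {RV P >-> tempered R d}) :=
  levy_exponent_schwartz f /\
  forall phi : schwartz R d,
    cintegral P (fun omega => cexp ('i * (w omega phi)%:C)%C) =
    cexp (cintegral (lebesgue_rV R d) (fun x => f (phi x))).

(* The norm of a complex number lives in [R[i]], hence the real part. *)
Definition growth_ratio (f : R -> R[i]) (p xi : R) : \bar R :=
  (complex.Re `|f xi| / `|xi| `^ p)%:E.

(* The filter [|xi| -> oo], on both sides of the real line. *)
Definition infty_nbhs : set_system R :=
  filter_from setT (fun M : R => [set xi | M < `|xi|]).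

(* [lime_sup] is the limit superior along punctured neighbourhoods. *)
Definition I_zero (f : R -> R[i]) : set R :=
  [set p | 0 <= p <= 2 /\ (lime_sup (growth_ratio f p) 0 < +oo)%E].

Definition I_infty (f : R -> R[i]) : set R :=
  [set p | 0 <= p <= 2 /\ (limf_esup (growth_ratio f p) infty_nbhs < +oo)%E].

Definition beta_zero (f : R -> R[i]) : R := sup (I_zero f).

Definition beta_infty (f : R -> R[i]) : R := inf (I_infty f).

End levy.

(* Both sides are extended reals, so that finiteness of the moment is part of
   the claim. *)
Definition moment_bound (R : realType) (d : nat) dO (Omega : measurableType dO)
    (P : probability Omega R) (w : {RV P >-> tempered R d}) (p b0 boo : R) :=
  exists2 C : R, 0 < C & forall phi : schwartz R d,
    ('E_P[fun omega => (`|w omega phi| `^ p)%R] <=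
     C%:E * ('N[lebesgue_rV R d]_(b0%:E)[EFin \o phi] `^ p +
             'N[lebesgue_rV R d]_(boo%:E)[EFin \o phi] `^ p))%E.

(* Main.v *)
Require Import Defs.
From HB Require Import structures.
From mathcomp Require Import all_boot all_order all_algebra.
From mathcomp Require Import all_classical all_reals all_analysis.
From mathcomp Require Import measurable_realfun complex.
From mathcomp Require Import ring lra.

Set Implicit Arguments.
Unset Strict Implicit.
Unset Printing Implicit Defensive.

Import Order.TTheory GRing.Theory Num.Theory.
Import numFieldNormedType.Exports.

Local Open Scope classical_set_scope.
Local Open Scope ring_scope.

(** For a fixed test function [phi] and [X = <w, phi>], linearity of [w] turns
    the characteristic functional into the characteristic function of [X], so
    that [E (1 - cos (t X))] is controlled, up to a factor 3, by the integral of
    [|Re f| + 2 |Im f|] along [t phi] ([expectation_one_subr_cos]).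
    Membership of [b0] and [boo] in the index sets, together with the continuity
    of [f] in between, bounds this size of [f] by
    [C (|xi|^b0 + |xi|^boo)] on the whole line ([levy_size_bound]).

    For [p < b0, boo], it suffices to bound [E |X|^p] uniformly over the [phi]
    whose two norms are at most 1: applying this to [phi / M], with [M] the
    maximum of the two norms, gives the general case
    ([moment_bound_of_normalized]).  The integral representation of
    [|x|^p] by [1 - cos] is replaced by a dyadic one: for [|x| >= 1] some scale
    [2^-k] brings [x] into [[1/2, 1]], where [1 - cos] is bounded below, hence
    [|x|^p <= 1 + 32 sum_k 2^(kp) (1 - cos (2^-k x))].  The expectation of the
    [k]-th term is [O(2^(k(p-b0)) + 2^(k(p-boo)))], a summable geometric bound
    ([moment_normalized]).

    For [p = 2] that geometric bound diverges, but only small frequencies are needed: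
    [u^2 <= 8 (1 - cos u)] on [[-1, 1]], so the part of [E X^2] over
    [|X| <= 2^n] is at most [8 4^n E (1 - cos (2^-n X))].  Since [phi] is
    bounded, [2^-n phi] eventually takes its values where [f] is
    [O(|xi|^2)], so this is at most a constant times the square of the
    [L^2] norm of [phi], uniformly in [n]; monotone convergence concludes
    ([second_moment_le]). *)

(** * Elementary bounds on the cosine *)

Section cosine.
Context {R : realType}.
Implicit Types a b u x p : R.

Lemma one_subr_cos_le_norm b : 1 - cos b <= `|b|.
Proof.
rewrite -(cos_norm b); have : 0 <= `|b| by [].
move: `|b| => c c0.
have [z _] := MVT_segment (f := cos) (df := fun x => - sin x) c0
  (fun x _ => is_derive_cos x)
  (continuous_subspaceT (@continuous_cos R)).
rewrite cos0 subr0 => h.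
have : sin z * c <= 1 * c by rewrite ler_wpM2r// sin_le1.
by lra.
Qed.

(** With [u = 2 v] one has [1 - cos u = 2 sin^2 v], and the mean value theorem
    gives [sin v >= v / 2] because [cos >= 1/2] on [[0, 1/2]]. *)
Lemma sqr_le_one_subr_cos u : `|u| <= 1 -> u ^+ 2 <= 8 * (1 - cos u).
Proof.
suff nonneg (v : R) : 0 <= v -> v <= 1 / 2 ->
    (2 * v) ^+ 2 <= 8 * (1 - cos (2 * v)).
  move=> u1; have u0 : 0 <= `|u| by [].
  have := nonneg (`|u| / 2); rewrite (mulrC 2) divfK ?pnatr_eq0// cos_norm.
  by rewrite real_normK ?num_real//; apply; lra.
move=> v0 v1.
have [z /[!in_itv]/= /andP[z0 zv]] := MVT_segment (f := sin) (df := cos) v0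
  (fun x _ => is_derive_sin x)
  (continuous_subspaceT (@continuous_sin R)).
rewrite sin0 !subr0 => sv.
have cz : 1 / 2 <= cos z.
  by have := one_subr_cos_le_norm z; rewrite ger0_norm//; lra.
rewrite mulr_natl cos_mulr2n cos2sin2 sv.
have : v * (1 / 2) <= cos z * v by rewrite mulrC ler_wpM2r.
move: (cos z * v) => s vs.
have : (v * (1 / 2)) ^+ 2 <= s ^+ 2.
  by rewrite ler_sqr// nnegrE ?(le_trans _ vs) ?mulr_ge0//; lra.
by rewrite !mulr2n !exprMn expr2 => h; nra.
Qed.

(** The left-hand side is [1 - Re (exp (a + i b))].  When [|b| <= 1] the
    cosine is nonnegative and [exp a >= 1 + a] applies; when [|b| > 1] the
    hypothesis, which holds for the real part of a characteristic function,
    makes the left-hand side at most 2. *)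
Lemma expR_cos_gap a b : -1 <= expR a * cos b ->
  1 - expR a * cos b <= `|a| + 2 * `|b|.
Proof.
move=> eab; have a0 : 0 <= `|a| by [].
have [b1|b1] := leP `|b| 1; last by lra.
have cb := one_subr_cos_le_norm b; have cb0 : 0 <= cos b by lra.
have cb1 := cos_le1 b.
have : (1 + a) * cos b <= expR a * cos b by rewrite ler_wpM2r// expR_ge1Dx.
have : - a * cos b <= `|a|.
  apply: le_trans (_ : `|a| * cos b <= _); last by rewrite ler_piMr.
  by rewrite ler_wpM2r// -normrN ler_norm.
by have : 0 <= `|b| by []; lra.
Qed.

Lemma powR_exprn x p k : 0 <= x -> (x ^+ k) `^ p = (x `^ p) ^+ k.
Proof.
move=> x0; elim: k => [|k IH]; first by rewrite !expr0 powR1.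
by rewrite !exprS powRM ?exprn_ge0// IH.
Qed.

Lemma exprVMn2 k : (2^-1 ^+ k : R) * 2 ^+ k = 1.
Proof. by rewrite -exprMn mulVf ?expr1n// pnatr_eq0. Qed.

Lemma expr2_archi x : exists k, x <= 2 ^+ k.
Proof.
exists (Num.truncn x).+1; apply: le_trans (ltW (truncnS_gt _)) _.
by rewrite -natrX ler_nat ltnW// ltn_expl.
Qed.

(** The least [k] with [|x| <= 2^k] puts [2^-k |x|] in [[1/2, 1]]; there
    [1 - cos] is at least [(1/2)^2 / 8 = 1/32]. *)
Lemma powR_le_dyadic_cos p x : 0 <= p -> 1 <= `|x| -> exists k,
  `|x| `^ p <= 32 * (2 `^ p) ^+ k * (1 - cos (2^-1 ^+ k * x)).
Proof.
move=> p0 x1.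
have ex := expr2_archi `|x|.
have [k xk kmin] := ex_minnP ex; exists k.
set u := _ * x.
have h2 := exprVMn2 k.
have h0 : 0 < (2^-1 : R) ^+ k by rewrite exprn_gt0.
have normu : `|u| = 2^-1 ^+ k * `|x| by rewrite normrM ger0_norm// ltW.
have u1 : `|u| <= 1 by rewrite normu (le_trans (ler_wpM2l (ltW h0) xk))// h2.
have u2 : 1 / 2 <= `|u|.
  case: k xk kmin @u h2 h0 normu u1 => [|k] xk kmin u h2 h0 normu u1.
    by rewrite normu expr0; lra.
  have : 2 ^+ k < `|x| by rewrite ltNge; apply/negP => /kmin; rewrite ltnn.
  rewrite normu => /ltW /(ler_wpM2l (ltW h0)); apply: le_trans.
  by move: h2; rewrite (exprS 2); lra.
have := sqr_le_one_subr_cos u1; rewrite -(real_normK (num_real u)) => cu.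
have c32 : 1 <= 32 * (1 - cos u) by nra.
rewrite -powR_exprn//.
apply: le_trans (_ : (2 ^+ k) `^ p <= _).
  by rewrite ge0_ler_powR// nnegrE exprn_ge0.
by rewrite [32 * _]mulrC -mulrA ler_peMr// powR_ge0.
Qed.

End cosine.

(** * Growth of the exponent *)

Section growth.
Context {R : realType}.
Implicit Types (f : R -> R[i]) (b xi : R).

(** Weighted so as to match the right-hand side of [expR_cos_gap]. *)
Definition levy_size f xi : R :=
  `|complex.Re (f xi)| + 2 * `|complex.Im (f xi)|.

Lemma levy_size_ge0 f xi : 0 <= levy_size f xi.
Proof. by rewrite addr_ge0// mulr_ge0. Qed.

Lemma levy_size0 f : f 0 = 0 -> levy_size f 0 = 0.
Proof. by rewrite /levy_size => ->; rewrite /= normr0 mulr0 addr0. Qed.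

Lemma continuous_levy_size f : continuous (fun xi => complex.Re (f xi)) ->
  continuous (fun xi => complex.Im (f xi)) -> continuous (levy_size f).
Proof.
move=> cr ci xi; apply: cvgD; first exact: cvg_norm (cr xi).
by apply: cvgM; [exact: cvg_cst|exact: cvg_norm (ci xi)].
Qed.

Lemma levy_size_le_norm f xi : levy_size f xi <= 3 * complex.Re `|f xi|.
Proof.
rewrite /levy_size normc_def /=; case: (f xi) => a b /=.
have : `|a| <= Num.sqrt (a ^+ 2 + b ^+ 2).
  by rewrite -sqrtr_sqr ler_wsqrtr// lerDl sqr_ge0.
have : `|b| <= Num.sqrt (a ^+ 2 + b ^+ 2).
  by rewrite -sqrtr_sqr ler_wsqrtr// lerDr sqr_ge0.
lra.
Qed.

(** The limit superior is an infimum of suprema over the filter: being finite,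
    it makes one of these suprema finite.  At [xi = 0] the denominator of the
    ratio may vanish. *)
Lemma limf_esup_growth_ratio f b (F : set_system R) :
  (limf_esup (growth_ratio f b) F < +oo)%E ->
  exists2 K, 0 <= K & exists2 V, F V & forall xi, V xi -> xi != 0 ->
    levy_size f xi <= K * `|xi| `^ b.
Proof.
move=> /ereal_inf_lt[_ [V FV <-]] supV.
exists (3 * Num.max 0 (fine (ereal_sup [set growth_ratio f b x | x in V]))).
  by rewrite mulr_ge0// le_max lexx.
exists V => // xi Vxi xi0; apply: le_trans (levy_size_le_norm _ _) _.
rewrite -mulrA ler_wpM2l//.
have x0 : 0 < `|xi| `^ b by rewrite powR_gt0// normr_gt0.
rewrite -ler_pdivrMr// le_max; apply/orP; right.
have gV : (growth_ratio f b xi <= ereal_sup [set growth_ratio f b x | x in V])%E.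
  by apply: ereal_sup_ubound; exists xi.
rewrite -lee_fin fineK// fin_numE -ltey supV andbT.
by rewrite gt_eqF// (lt_le_trans _ gV)// ltNyr.
Qed.

Lemma I_zero_bound f b : f 0 = 0 -> b \in I_zero f ->
  exists2 K, 0 <= K & exists2 r, 0 < r &
    forall xi, `|xi| < r -> levy_size f xi <= K * `|xi| `^ b.
Proof.
move=> f0; rewrite inE => -[_ /limf_esup_growth_ratio[K K0 [V FV HV]]].
exists K => //.
have [r /= r0 rV] : \forall x \near 0, x != 0 -> V x by exact: FV.
exists r => // xi xir; have [->|xi0] := eqVneq xi 0.
  by rewrite levy_size0// mulr_ge0// powR_ge0.
by apply: HV => //; apply: rV => //=; rewrite sub0r normrN.
Qed.

Lemma I_infty_bound f b : b \in I_infty f ->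
  exists2 K, 0 <= K & exists2 M, 0 < M &
    forall xi, M < `|xi| -> levy_size f xi <= K * `|xi| `^ b.
Proof.
rewrite inE => -[_ /limf_esup_growth_ratio[K K0 [V [M _ MV] HV]]].
exists K => //; exists (Num.max 1 M); first by rewrite lt_max ltr01.
move=> xi; rewrite gt_max => /andP[xi1 xiM]; apply: HV; first exact: MV.
by rewrite -normr_gt0 (lt_trans _ xi1).
Qed.

(** Between the neighbourhood of 0 and that of infinity, the continuous function
    [levy_size f] is bounded by compactness and [|xi|^b0] is bounded below. *)
Lemma levy_size_bound f b0 boo :
  continuous (fun xi => complex.Re (f xi)) ->
  continuous (fun xi => complex.Im (f xi)) ->
  f 0 = 0 -> 0 <= b0 -> b0 \in I_zero f -> boo \in I_infty f ->
  exists2 C, 0 <= C & forall xi,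
    levy_size f xi <= C * (`|xi| `^ b0 + `|xi| `^ boo).
Proof.
move=> cr ci f0 b0_ge0 /(I_zero_bound f0)[K K0 [r r0 Kr]].
move=> /I_infty_bound[L L0 [M M0 LM]].
have NMM : - M <= M by lra.
have [c _ cmax] :=
  EVT_max NMM (continuous_subspaceT (continuous_levy_size cr ci)).
have rb0 : 0 < r `^ b0 by rewrite powR_gt0.
pose B := levy_size f c / r `^ b0.
have B0 : 0 <= B by rewrite divr_ge0 ?levy_size_ge0// ltW.
exists (K + L + B) => [|xi]; first by rewrite !addr_ge0.
have : 0 <= `|xi| `^ b0 by exact: powR_ge0.
have : 0 <= `|xi| `^ boo by exact: powR_ge0.
have [/Kr|rxi] := ltP `|xi| r; first nra.
have [/LM|xiM] := ltP M `|xi|; first nra.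
have lc : levy_size f xi <= levy_size f c.
  by apply: cmax; rewrite in_itv /= -ler_norml.
have : r `^ b0 <= `|xi| `^ b0 by rewrite ge0_ler_powR// nnegrE ltW.
move=> /(ler_wpM2l B0); rewrite /B divfK ?gt_eqF// -/B.
by nra.
Qed.

End growth.

(** * Borel sets of row vectors *)

Section rV_measurability.
Context {R : realType} {d : nat}.

Lemma measurable_rV_cube (c : 'rV[R]_d) (e : R) :
  measurable [set x : 'rV[R]_d | forall i, `|x ord0 i - c ord0 i| < e].
Proof.
rewrite (_ : mkset _ =
  \bigcap_(i in [set: 'I_d])
    ((fun x : 'rV[R]_d => x ord0 i) @^-1` ball (c ord0 i) e)).
  apply: fin_bigcap_measurable => // i _.
  rewrite -[X in measurable X]setTI; apply: measurable_coord => //.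
  by rewrite ball_itv; exact: measurable_itv.
apply/seteqP; split => [x xc i _|x xc i].
  by rewrite /ball/= distrC; exact: xc.
by have := xc i Logic.I; rewrite /= /ball/= distrC.
Qed.

(** The measurable sets of ['rV_d] are generated by the coordinates; an open set
    is a countable union of cubes with rational centres. *)
Lemma open_measurable_rV (U : set 'rV[R]_d) : open U -> measurable U.
Proof.
move=> oU.
pose cube (q : 'rV[rat]_d * nat) := [set x : 'rV[R]_d |
  forall i, `|x ord0 i - (map_mx ratr q.1) ord0 i| < (q.2.+1%:R)^-1].
rewrite (_ : U = \bigcup_q (if `[< cube q `<=` U >] then cube q else set0)).
  apply: countable_bigcupT_measurable => // q.
  by case: ifP => // _; exact: measurable_rV_cube.
apply/seteqP; split => [x Ux|x [q _]]; last first.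
  by case: ifP => // /asboolP qU /qU.
have [e /= e0 xeU] : nbhs_ball x U by apply/nbhs_ballP; exact: open_nbhs_nbhs.
have [N _ /(_ N (leqnn _)) Ne] :=
  near_infty_natSinv_lt (PosNum (divr_gt0 e0 (ltr0n R 2))).
have N0 : 0 < N.+1%:R^-1 :> R by rewrite invr_gt0.
have qex i : exists q : rat, `|x ord0 i - ratr q| < N.+1%:R^-1.
  have /rat_in_itvoo[q] : x ord0 i - N.+1%:R^-1 < x ord0 i + N.+1%:R^-1.
    by rewrite ltrBlDr -addrA ltrDl addr_gt0.
  by rewrite in_itv/= => q_itv; exists q; rewrite distrC ltr_distl.
have [q Hq] := choice qex.
exists (\row_i q i, N) => //; rewrite asboolT; last first.
  move=> y /= yq; apply: xeU; split => // i j; rewrite (ord1 i).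
  have := yq j; rewrite !mxE /ball/= => yqj; have xqj := Hq j.
  have -> : x ord0 j - y ord0 j =
    (x ord0 j - ratr (q j)) - (y ord0 j - ratr (q j)) by lra.
  apply: le_lt_trans (ler_normB _ _) _; rewrite [e]splitr.
  by move: Ne => /= Ne; apply: ltrD; [exact: lt_trans Ne|exact: lt_trans Ne].
by move=> i; rewrite !mxE.
Qed.

Lemma continuous_rV_measurable (phi : 'rV[R]_d -> R) :
  continuous phi -> measurable_fun setT phi.
Proof.
move=> /continuousP cphi; apply: (measurability _ (RGenOpens.measurableE R)).
move=> _ [_ [a [b ->] <-]]; rewrite setTI; apply: open_measurable_rV.
exact/cphi/interval_open.
Qed.

End rV_measurability.

(** * Integrals *)

Section integral_bounds.
Context d (T : measurableType d) (R : realType) (mu : {measure set T -> \bar R}).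

(** The real-valued integral is 0 when the extended one is infinite; the bound
    on [h] rules this case out, so the extended triangle inequality applies. *)
Lemma normr_Rintegral_le (g h : T -> R) (c : R) :
  measurable_fun setT g -> measurable_fun setT h ->
  (forall x, `|g x| <= h x) -> (\int[mu]_x (h x)%:E <= c%:E)%E ->
  `|\int[mu]_x g x| <= c.
Proof.
move=> mg mh gh hc.
have : (`|\int[mu]_x (g x)%:E| <= c%:E)%E.
  apply: le_trans (le_abse_integral _ _ _) _ => //; first exact/measurable_EFinP.
  apply: le_trans hc; apply: ge0_le_integral => //.
  - by apply/measurable_EFinP/measurableT_comp.
  - exact/measurable_EFinP.
  - by move=> x _; rewrite lee_fin gh.
by rewrite /Rintegral; case: (integral _ _ _) => [r| |].
Qed.

Lemma measurable_normr_powR (g : T -> R) (b : R) :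
  measurable_fun setT g -> measurable_fun setT (fun x => `|g x| `^ b).
Proof.
move=> mg; apply: (measurableT_comp (f := fun x : R => x `^ b)).
  exact: measurable_powR.
exact: measurableT_comp.
Qed.

Lemma integral_comb_le (u v : T -> R) (A B a b : R) :
  measurable_fun setT u -> measurable_fun setT v ->
  (forall x, 0 <= u x) -> (forall x, 0 <= v x) -> 0 <= A -> 0 <= B ->
  (\int[mu]_x (u x)%:E <= a%:E)%E -> (\int[mu]_x (v x)%:E <= b%:E)%E ->
  (\int[mu]_x (A * u x + B * v x)%:E <= (A * a + B * b)%:E)%E.
Proof.
move=> mu0 mv u0 v0 A0 B0 ua vb.
under eq_integral do rewrite EFinD !EFinM.
have mEu : measurable_fun setT (EFin \o u) by exact/measurable_EFinP.
have mEv : measurable_fun setT (EFin \o v) by exact/measurable_EFinP.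
rewrite ge0_integralD//.
- have Eu0 x : setT x -> (0 <= (u x)%:E)%E by rewrite lee_fin.
  have Ev0 x : setT x -> (0 <= (v x)%:E)%E by rewrite lee_fin.
  rewrite !ge0_integralZl_EFin//.
  by rewrite EFinD !EFinM; apply: leeD; apply: lee_wpmul2l; rewrite ?lee_fin.
- by move=> x _; rewrite mule_ge0 ?lee_fin.
- exact: measurable_funeM.
- by move=> x _; rewrite mule_ge0 ?lee_fin.
- exact: measurable_funeM.
Qed.

End integral_bounds.

(** * The characteristic functional *)

Section characteristic_functional.
Context (R : realType) (d : nat) (dO : measure_display)
  (Omega : measurableType dO) (P : probability Omega R) (f : R -> R[i])
  (w : {RV P >-> tempered R d}).
Implicit Types phi : schwartz R d.

Lemma schwartz_continuous phi : continuous phi.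
Proof.
move=> x; apply: differentiable_continuous.
exact: (schwartz_smooth phi [::]).
Qed.

Lemma schwartz_measurable phi : measurable_fun setT phi.
Proof. by apply: continuous_rV_measurable; exact: schwartz_continuous. Qed.

(** Evaluation at [phi] pulls a Borel set back to a one-dimensional cylinder. *)
Lemma measurable_pairing phi : measurable_fun setT (fun omega => w omega phi).
Proof.
move=> _ B mB; rewrite setTI.
pose B1 := (fun t : 1.-tuple R => tnth t ord0) @^-1` B.
have mB1 : measurable B1.
  by rewrite -[X in measurable X]setTI; exact: (measurable_tnth ord0).
have -> : (fun omega => w omega phi) @^-1` B =
    w @^-1` [set u : tempered R d | B1 [tuple of map u [tuple phi]]].
  by apply/seteqP; split => omega /=; rewrite /B1 /= tnth_map.
rewrite -[X in measurable X]setTI; apply: measurable_funPT => //.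
by apply: sub_sigma_algebra; exists 0%N, [tuple phi], B1.
Qed.

Lemma pairingZ (a : R) phi omega : w omega (a *: phi) = a * w omega phi.
Proof. exact: linearZ. Qed.

Lemma measurable_one_subr_cos phi (a : R) :
  measurable_fun setT (fun omega => 1 - cos (a * w omega phi)).
Proof.
apply: measurable_funB => //.
apply: (measurableT_comp (f := @cos R)).
  by apply: continuous_measurable_fun; exact: continuous_cos.
by apply: measurable_funM => //; exact: measurable_pairing.
Qed.

Lemma measurable_levy_size phi : levy_white_noise f w ->
  measurable_fun setT (fun x => levy_size f (phi x)).
Proof.
move=> [[mu [_ cRe cIm _ _] _] _].
apply: (measurableT_comp (f := levy_size f)); last exact: schwartz_measurable.
by apply: continuous_measurable_fun; exact: continuous_levy_size.
Qed.

(** The real part of the characteristic functional is [E (cos X)] on one side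
    and [exp a cos b] on the other, where [a + i b] is the integral of [f] along
    [phi]; both [|a|] and [|b|] are at most [c]. *)
Lemma expectation_one_subr_cos phi (c : R) :
  levy_white_noise f w ->
  (\int[lebesgue_rV R d]_x (levy_size f (phi x))%:E <= c%:E)%E ->
  (\int[P]_omega (1 - cos (w omega phi))%:E <= (3 * c)%:E)%E.
Proof.
move=> w_noise; have msize := measurable_levy_size phi w_noise.
case: w_noise => -[mu [_ cRe cIm _ _] _] /(_ phi).
have mRe : measurable_fun setT (fun x => complex.Re (f (phi x))).
  apply: (measurableT_comp (f := fun xi => complex.Re (f xi))).
    exact: continuous_measurable_fun.
  exact: schwartz_measurable.
have mIm : measurable_fun setT (fun x => complex.Im (f (phi x))).
  apply: (measurableT_comp (f := fun xi => complex.Im (f xi))).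
    exact: continuous_measurable_fun.
  exact: schwartz_measurable.
rewrite /cintegral /=; set a := Rintegral _ _ (fun x => complex.Re (f _)).
set b := Rintegral _ _ (fun x => complex.Im (f _)).
move=> /(congr1 (@complex.Re R)) /=.
have -> : (fun omega => complex.Re (cexp ('i * (w omega phi)%:C)%C)) =
    (fun omega => cos (w omega phi)).
  by apply/funext => omega; rewrite /= !mul0r !mul1r subrr expR0 mul1r add0r.
move=> charE sizec.
have mcos : measurable_fun setT (fun omega => cos (w omega phi)).
  apply: (measurableT_comp (f := @cos R)); last exact: measurable_pairing.
  by apply: continuous_measurable_fun; exact: continuous_cos.
have PT : (\int[P]_omega (1 : R)%:E = 1)%E.
  rewrite (integral_cst P measurableT 1%:E) mul1e.
  exact: probability_setT.
have P1 : (\int[P]_omega (cst 1 omega)%:E <= 1%:E)%E by rewrite PT.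
have cos1 : `|\int[P]_omega cos (w omega phi)| <= 1.
  by apply: normr_Rintegral_le P1 => // omega; exact: cos_max.
have ale : `|a| <= c.
  apply: normr_Rintegral_le sizec => // x.
  by rewrite /levy_size lerDl mulr_ge0.
have ble : `|b| <= c.
  apply: normr_Rintegral_le sizec => // x.
  have := normr_ge0 (complex.Re (f (phi x))).
  by have := normr_ge0 (complex.Im (f (phi x))); rewrite /levy_size; lra.
have icos : P.-integrable setT (EFin \o (fun omega => cos (w omega phi))).
  apply: measurable_bounded_integrable => //.
    by rewrite (le_lt_trans (probability_le1 _ _))// ltry.
  exists 1; split => // x x1 omega _ /=; exact: le_trans (cos_max _) (ltW x1).
under eq_integral do rewrite EFinB.
rewrite integralB//; last exact: finite_measure_integrable_cst.
have -> : (\int[P]_omega (cos (w omega phi))%:E = (expR a * cos b)%:E)%E.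
  by rewrite -charE fineK//; exact: integrable_fin_num.
rewrite PT -EFinB lee_fin.
have : -1 <= expR a * cos b.
  by move: cos1; rewrite charE ler_norml => /andP[].
by move=> /expR_cos_gap; lra.
Qed.

End characteristic_functional.

(** * Moments of order less than both indices *)

Section geometric.
Context {R : realType}.

Lemma nneseries_geometric (a z : R) : 0 <= a -> 0 <= z < 1 ->
  (\sum_(0 <= k <oo) (a * z ^+ k)%:E = (a / (1 - z))%:E)%E.
Proof.
move=> a0 /andP[z0 z1].
have az : `|z| < 1 by rewrite ger0_norm.
have cv := @cvg_geometric_series R a z az.
rewrite (_ : (fun n => _) = EFin \o series (geometric a z)).
  rewrite EFin_lim; first by congr EFin; exact: cvg_lim.
  by apply/cvg_ex; eexists; exact: cv.
by apply/funext => n; rewrite /= /series /= -sumEFin.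
Qed.

End geometric.

Section moments.
Context (R : realType) (d : nat) (dO : measure_display)
  (Omega : measurableType dO) (P : probability Omega R) (f : R -> R[i])
  (w : {RV P >-> tempered R d}).
Hypothesis w_noise : levy_white_noise f w.
Implicit Types phi : schwartz R d.

Lemma dyadic_one_subr_cos (C b0 boo : R) phi (k : nat) : 0 <= C ->
  (forall xi, levy_size f xi <= C * (`|xi| `^ b0 + `|xi| `^ boo)) ->
  (\int[lebesgue_rV R d]_x (`|phi x| `^ b0)%:E <= 1%:E)%E ->
  (\int[lebesgue_rV R d]_x (`|phi x| `^ boo)%:E <= 1%:E)%E ->
  (\int[P]_omega (1 - cos (2^-1 ^+ k * w omega phi))%:E <=
   (3 * C * ((2^-1 `^ b0) ^+ k + (2^-1 `^ boo) ^+ k))%:E)%E.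
Proof.
move=> C0 fC phi0 phioo.
have h0 : 0 <= (2^-1 : R) by rewrite invr_ge0.
under eq_integral do rewrite -pairingZ.
rewrite -mulrA; apply: (expectation_one_subr_cos w_noise).
set A := (2^-1 `^ b0) ^+ k; set B := (2^-1 `^ boo) ^+ k.
have [A0 B0] : 0 <= A /\ 0 <= B by split; rewrite exprn_ge0// powR_ge0.
have mphi := schwartz_measurable phi.
apply: le_trans (_ : (\int[lebesgue_rV R d]_x
  ((C * A) * `|phi x| `^ b0 + (C * B) * `|phi x| `^ boo)%:E <= _)%E); last first.
  rewrite (_ : C * (A + B) = C * A * 1 + C * B * 1).
    apply: integral_comb_le; rewrite ?mulr_ge0 => //.
    - exact: measurable_normr_powR.
    - exact: measurable_normr_powR.
  by rewrite !mulr1 mulrDr.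
apply: ge0_le_integral => //.
- by move=> x _; rewrite lee_fin levy_size_ge0.
- by apply/measurable_EFinP; exact: (measurable_levy_size _ w_noise).
- apply/measurable_EFinP; apply: measurable_funD; apply: measurable_funM => //.
  + exact: measurable_normr_powR.
  + exact: measurable_normr_powR.
move=> x _; rewrite lee_fin; apply: le_trans (fC _) _.
rewrite -[schwartz_fun _ x]/(2^-1 ^+ k * phi x) normrM ger0_norm ?exprn_ge0//.
rewrite !powRM ?exprn_ge0// !powR_exprn// -/A -/B.
by rewrite mulrDr !mulrA.
Qed.

(** The factor [2^(kp)] of the dyadic majorant of [|x|^p] meets a decay
    [2^(-k b)] of the expectation, whence a convergent geometric series of ratio
    [r b = 2^(p - b)] for [b = b0] and [b = boo]. *)
Lemma moment_normalized (C p b0 boo : R) :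
  0 <= C -> 0 < p -> p < b0 -> p < boo ->
  (forall xi, levy_size f xi <= C * (`|xi| `^ b0 + `|xi| `^ boo)) ->
  exists2 K, 0 < K & forall phi,
    (\int[lebesgue_rV R d]_x (`|phi x| `^ b0)%:E <= 1%:E)%E ->
    (\int[lebesgue_rV R d]_x (`|phi x| `^ boo)%:E <= 1%:E)%E ->
    (\int[P]_omega (`|w omega phi| `^ p)%:E <= K%:E)%E.
Proof.
move=> C0 p0 pb0 pboo fC.
pose r (b : R) : R := 2 `^ p * 2^-1 `^ b.
have r01 b : p < b -> 0 <= r b < 1.
  move=> pb; rewrite /r mulr_ge0 ?powR_ge0//=.
  have h1 : 2 `^ b * 2^-1 `^ b = 1 :> R.
    by rewrite -powRM// ?divff ?powR1.
  rewrite -[ltRHS]h1 ltr_pM2r ?powR_gt0// /powR pnatr_eq0/= ltr_expR ltr_pM2r//.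
  by rewrite ln_gt0// ltr1n.
have /andP[rb0_ge0 rb0_lt1] := r01 _ pb0.
have /andP[rboo_ge0 rboo_lt1] := r01 _ pboo.
pose K := 1 + (96 * C / (1 - r b0) + 96 * C / (1 - r boo)).
exists K.
  by rewrite ltr_pwDl// addr_ge0// divr_ge0 ?mulr_ge0// subr_ge0 ltW.
move=> phi phi0 phioo.
pose F k omega : \bar R :=
  (32 * (2 `^ p) ^+ k * (1 - cos (2^-1 ^+ k * w omega phi)))%:E.
have F0 k omega : (0 <= F k omega)%E.
  by rewrite lee_fin mulr_ge0 ?subr_ge0 ?cos_le1// mulr_ge0 ?exprn_ge0 ?powR_ge0.
have mF k : measurable_fun setT (F k).
  apply/measurable_EFinP; apply: measurable_funM => //.
  exact: measurable_one_subr_cos.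
have mS : measurable_fun setT (fun omega => \sum_(0 <= k <oo) F k omega)%E.
  by apply: ge0_emeasurable_sum => // k omega _ _; exact: F0.
have mX : measurable_fun setT (fun omega => `|w omega phi| `^ p).
  by apply: measurable_normr_powR; exact: measurable_pairing.
apply: (@le_trans _ _ (\int[P]_omega (1%:E + \sum_(0 <= k <oo) F k omega))%E).
  apply: ge0_le_integral => //.
  - exact/measurable_EFinP.
  - exact: emeasurable_funD.
  move=> omega _.
  have S0 n : (\sum_(0 <= k < n) F k omega <= \sum_(0 <= k <oo) F k omega)%E.
    by apply: nneseries_lim_ge => k _ _; exact: F0.
  have [x1|x1] := leP 1 `|w omega phi|; last first.
    rewrite -[leLHS]adde0 leeD//.
      have := ge0_ler_powR (ltW p0) (normr_ge0 (w omega phi)) ler01 (ltW x1).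
      by rewrite powR1 lee_fin.
    by apply: le_trans (S0 0%N); rewrite big_geq.
  have [k xk] := powR_le_dyadic_cos (ltW p0) x1.
  apply: (@le_trans _ _ (F k omega)); first by rewrite lee_fin.
  rewrite -[leLHS]add0e leeD ?lee_fin//; apply: le_trans (S0 k.+1).
  by rewrite big_nat_recr//= -[leLHS]add0e leeD// sume_ge0.
rewrite ge0_integralD//; last first.
  by move=> omega _; apply: nneseries_ge0 => k _ _; exact: F0.
rewrite (integral_cst P measurableT 1%:E) mul1e /K EFinD.
apply: leeD; first exact: probability_le1.
rewrite integral_nneseries//.
rewrite EFinD -!nneseries_geometric ?rb0_ge0 ?rboo_ge0 ?mulr_ge0//.
rewrite -nneseriesD; last 2 first.
- by move=> k _ _; rewrite lee_fin !mulr_ge0// exprn_ge0.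
- by move=> k _ _; rewrite lee_fin !mulr_ge0// exprn_ge0.
apply: lee_nneseries => k _; first by move=> _; exact: integral_ge0.
rewrite /F; under eq_integral do rewrite EFinM.
rewrite ge0_integralZl_EFin//; last first.
  by apply/measurable_EFinP; exact: measurable_one_subr_cos.
apply: le_trans (lee_wpmul2l _ (dyadic_one_subr_cos k C0 fC phi0 phioo)) _.
  by rewrite lee_fin mulr_ge0// exprn_ge0// powR_ge0.
rewrite -EFinM -EFinD lee_fin /r !exprMn.
move: (_ ^+ k) (_ ^+ k) (_ ^+ k) => x y z; lra.
Qed.

End moments.

(** * Reduction to normalized test functions *)

Section scaling.
Context (R : realType) (d : nat) (dO : measure_display)
  (Omega : measurableType dO) (P : probability Omega R)
  (w : {RV P >-> tempered R d}).
Implicit Types phi : schwartz R d.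

Local Notation Lb b phi := ('N[lebesgue_rV R d]_(b%:E)[EFin \o phi])%E.

Lemma integral_normr_powR phi (b : R) : b != 0 ->
  (\int[lebesgue_rV R d]_x (`|phi x| `^ b)%:E = Lb b phi `^ b)%E.
Proof. by move=> b0; rewrite powR_Lnorm. Qed.

Lemma normalized_integral phi (b M : R) :
  0 < b -> 0 < M -> (Lb b phi <= M%:E)%E ->
  (\int[lebesgue_rV R d]_x (`|(M^-1 *: phi : schwartz R d) x| `^ b)%:E <= 1%:E)%E.
Proof.
move=> b0 M0 NM.
have Mb : 0 < M `^ b by rewrite powR_gt0.
under eq_integral => x _.
  rewrite -[schwartz_fun _ x]/(M^-1 * phi x) normrM powRM// EFinM.
  over.
rewrite /= ge0_integralZl_EFin ?powR_ge0//; last first.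
  by apply/measurable_EFinP; apply: measurable_normr_powR; exact: schwartz_measurable.
rewrite integral_normr_powR ?gt_eqF//.
have NMb : (Lb b phi `^ b <= M%:E `^ b)%E.
  apply: gt0_ler_poweR => //; first exact: ltW.
    by rewrite in_itv/= leey andbT Lnorm_ge0.
  by rewrite in_itv/= leey andbT lee_fin ltW.
apply: le_trans (lee_wpmul2l _ NMb) _; first by rewrite lee_fin powR_ge0.
rewrite poweR_EFin -EFinM lee_fin -powRM//; last exact: ltW.
by rewrite gtr0_norm ?invr_gt0// mulVf ?powR1// gt_eqF.
Qed.

Lemma moment_scaling (K p b0 boo M : R) phi : 0 < b0 -> 0 < boo -> 0 < M ->
  (forall psi : schwartz R d,
    (\int[lebesgue_rV R d]_x (`|psi x| `^ b0)%:E <= 1%:E)%E ->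
    (\int[lebesgue_rV R d]_x (`|psi x| `^ boo)%:E <= 1%:E)%E ->
    (\int[P]_omega (`|w omega psi| `^ p)%:E <= K%:E)%E) ->
  (Lb b0 phi <= M%:E)%E -> (Lb boo phi <= M%:E)%E ->
  (\int[P]_omega (`|w omega phi| `^ p)%:E <= (K * M `^ p)%:E)%E.
Proof.
move=> b0_gt0 boo_gt0 M0 normalized N0 Noo.
pose psi : schwartz R d := M^-1 *: phi.
have wE omega : `|w omega phi| `^ p = M `^ p * `|w omega psi| `^ p.
  rewrite /psi pairingZ normrM powRM// mulrA -powRM//; last exact: ltW.
  by rewrite gtr0_norm ?invr_gt0// divff ?gt_eqF// powR1 mul1r.
under eq_integral do rewrite wE EFinM.
rewrite ge0_integralZl_EFin ?powR_ge0//; last first.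
  by apply/measurable_EFinP; apply: measurable_normr_powR; exact: measurable_pairing.
rewrite mulrC EFinM lee_wpmul2l ?lee_fin ?powR_ge0//.
by apply: normalized; exact: normalized_integral.
Qed.

(** [M] is the maximum [m] of the two norms.  When [m = 0], [moment_scaling]
    applies to every [M > 0] and [M -> 0] gives a vanishing moment; infinite
    norms make the right-hand side infinite. *)
Lemma moment_bound_of_normalized (K p b0 boo : R) :
  0 < K -> 0 < p -> 0 < b0 -> 0 < boo ->
  (forall psi : schwartz R d,
    (\int[lebesgue_rV R d]_x (`|psi x| `^ b0)%:E <= 1%:E)%E ->
    (\int[lebesgue_rV R d]_x (`|psi x| `^ boo)%:E <= 1%:E)%E ->
    (\int[P]_omega (`|w omega psi| `^ p)%:E <= K%:E)%E) ->
  moment_bound w p b0 boo.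
Proof.
move=> K0 p0 b0_gt0 boo_gt0 normalized; exists K => // phi.
rewrite unlock.
have N0_ge0 : (0 <= Lb b0 phi)%E by exact: Lnorm_ge0.
have Noo_ge0 : (0 <= Lb boo phi)%E by exact: Lnorm_ge0.
have := fun M M0 => @moment_scaling K p b0 boo M phi b0_gt0 boo_gt0 M0 normalized.
case: (Lb b0 phi) N0_ge0 => [n0| |]// + bound; last first.
  by rewrite poweRyr ?gt_eqF// addye ?gt0_muley ?leey//
    gt_eqF// (lt_le_trans _ (poweR_ge0 _ _)).
case: (Lb boo phi) Noo_ge0 bound => [noo| |]// + bound; last first.
  by rewrite poweRyr ?gt_eqF// addey ?gt0_muley ?leey//
    gt_eqF// (lt_le_trans _ (poweR_ge0 _ _)).
rewrite !lee_fin !poweR_EFin -EFinD -EFinM => noo0 n00.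
pose m := Num.max n0 noo.
have m0 : 0 <= m by rewrite le_max n00.
have mp : m `^ p <= n0 `^ p + noo `^ p.
  by rewrite /m; have [_|_] := leP n0 noo;
    [rewrite lerDr|rewrite lerDl]; exact: powR_ge0.
apply: (@le_trans _ _ (K * m `^ p)%:E); last by rewrite lee_fin ler_wpM2l// ltW.
move: m0; rewrite le_eqVlt => /predU1P[m0|m0]; last first.
  by apply: bound; rewrite ?lee_fin// le_max lexx ?orbT.
rewrite -m0 powR0 ?gt_eqF// mulr0; apply/lee_addgt0Pr => e e0.
rewrite add0e.
have eK : 0 < e / K by rewrite divr_gt0.
apply: le_trans (bound ((e / K) `^ p^-1) _ _ _) _.
- by rewrite powR_gt0.
- by rewrite lee_fin (@le_trans _ _ m) ?le_max ?lexx// -m0 powR_ge0.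
- by rewrite lee_fin (@le_trans _ _ m) ?le_max ?lexx ?orbT// -m0 powR_ge0.
- rewrite lee_fin -powRrM mulVf ?gt_eqF// powRr1; last exact: ltW.
  by rewrite mulrC divfK ?gt_eqF.
Qed.

End scaling.

(** * The second moment *)

Section second_moment.
Context (R : realType) (d : nat) (dO : measure_display)
  (Omega : measurableType dO) (P : probability Omega R) (f : R -> R[i])
  (w : {RV P >-> tempered R d}).
Hypothesis w_noise : levy_white_noise f w.
Implicit Types phi : schwartz R d.

Lemma schwartz_bounded phi : exists2 B, 0 < B & forall x, `|phi x| <= B.
Proof.
have := schwartz_funP phi; rewrite inE => -[_ /(_ 0%N [::])].
have bound x := schwartz_seminorm_ge 0 [::] phi x.
case: (schwartz_seminorm _ _ _) bound => [r| |]// bound _.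
  exists (Num.max 1 r); first by rewrite lt_max ltr01.
  by move=> x; have := bound x; rewrite expr0 mul1r lee_fin le_max orbC => ->.
by have := bound 0.
Qed.

(** The integral of [X^2] over [A n] is compared with
    [8 4^n E (1 - cos (2^-n X))].  The factor [4^n] cancels the [4^-n] that comes
    from the quadratic bound on [f], which is available once [2^-n phi] stays
    within the radius [r]. *)
Lemma second_moment_le (K r S : R) phi : 0 <= K -> 0 < r ->
  (forall xi, `|xi| < r -> levy_size f xi <= K * `|xi| `^ 2) ->
  (\int[lebesgue_rV R d]_x (`|phi x| `^ 2)%:E <= S%:E)%E ->
  (\int[P]_omega (`|w omega phi| `^ 2)%:E <= (24 * K * S)%:E)%E.
Proof.
move=> K0 r0 fK phiS.
have [B B0 phiB] := schwartz_bounded phi.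
have mphi := schwartz_measurable phi.
have h0 k : 0 < (2^-1 : R) ^+ k by rewrite exprn_gt0.
have gap n : 2^-1 ^+ n * B < r ->
  (\int[P]_omega (1 - cos (2^-1 ^+ n * w omega phi))%:E <=
    (3 * (K * (2^-1 ^+ n) ^+ 2 * S))%:E)%E.
  move=> nB.
  under eq_integral do rewrite -pairingZ.
  apply: (expectation_one_subr_cos w_noise).
  rewrite EFinM; apply: le_trans (lee_wpmul2l _ phiS); last first.
    by rewrite lee_fin mulr_ge0// exprn_ge0// ltW.
  rewrite -ge0_integralZl_EFin//; last 2 first.
  - by apply/measurable_EFinP; exact: measurable_normr_powR.
  - by rewrite mulr_ge0// exprn_ge0// ltW.
  apply: ge0_le_integral => //.
  - by move=> x _; rewrite lee_fin levy_size_ge0.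
  - by apply/measurable_EFinP; exact: (measurable_levy_size _ w_noise).
  - apply/measurable_EFinP; apply: measurable_funM => //.
    exact: measurable_normr_powR.
  move=> x _; rewrite lee_fin.
  rewrite -[schwartz_fun _ x]/(2^-1 ^+ n * phi x).
  have nx : `|2^-1 ^+ n * phi x| = 2^-1 ^+ n * `|phi x|.
    by rewrite normrM gtr0_norm.
  apply: le_trans (fK _ _) _.
    by rewrite nx (le_lt_trans _ nB)// ler_wpM2l// ltW.
  by rewrite nx -mulrA ler_wpM2l// !powR_mulrn ?exprMn// mulr_ge0// ltW.
pose A n := [set omega | `|w omega phi| <= 2 ^+ n].
have mX := measurable_pairing w phi.
have mA n : measurable (A n).
  rewrite (_ : A n = (fun omega => `|w omega phi|) @^-1` `]-oo, 2 ^+ n]).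
    rewrite -[X in measurable X]setTI.
    by apply: (measurableT_comp _ mX) => //; exact: measurable_itv.
  by apply/seteqP; split => omega /=; rewrite in_itv.
have ndA : nondecreasing_seq A.
  move=> m n mn; apply/subsetPset => omega /= /le_trans; apply.
  by rewrite ler_eXn2l// ltr1n.
have AT : \bigcup_n A n = setT.
  apply/seteqP; split => // omega _.
  by have [n Xn] := expr2_archi `|w omega phi|; exists n.
have mX2 : measurable_fun setT (fun omega => (`|w omega phi| `^ 2)%:E).
  by apply/measurable_EFinP; exact: measurable_normr_powR.
rewrite -AT.
have cv := @ge0_nondecreasing_set_cvg_integral _ _ _ A _ P ndA mA
  (fun n => measurable_funS measurableT (@subsetT _ _) mX2)
  (fun n omega _ => powR_ge0 _ _).
rewrite -(cvg_lim _ cv)//; apply: lime_le; first by apply/cvg_ex; eexists; exact: cv.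
near=> n.
have nB : 2^-1 ^+ n * B < r.
  rewrite -ltr_pdivlMr//; near: n.
  apply: (cvgr_lt (0 : R)); last by rewrite divr_gt0.
  by apply: cvg_expr; rewrite ger0_norm// invf_lt1// ltr1n.
have mcos : measurable_fun setT
    (fun omega => (1 - cos (2^-1 ^+ n * w omega phi))%:E).
  by apply/measurable_EFinP; exact: measurable_one_subr_cos.
have cos0 omega : (0 <= (1 - cos (2^-1 ^+ n * w omega phi))%:E)%E.
  by rewrite lee_fin subr_ge0 cos_le1.
apply: (@le_trans _ _ (\int[P]_omega
  ((8 * (2 ^+ n) ^+ 2)%:E * (1 - cos (2^-1 ^+ n * w omega phi))%:E))%E); last first.
  rewrite ge0_integralZl_EFin//.
  apply: le_trans (lee_wpmul2l _ (gap n nB)) _.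
    by rewrite lee_fin mulr_ge0// exprn_ge0// exprn_ge0.
  rewrite -EFinM lee_fin le_eqVlt; apply/orP; left; apply/eqP.
  transitivity (24 * K * S * (2^-1 ^+ n * 2 ^+ n) ^+ 2); first by ring.
  by rewrite exprVMn2 expr1n mulr1.
have mh : measurable_fun setT (fun omega =>
    ((8 * (2 ^+ n) ^+ 2)%:E * (1 - cos (2^-1 ^+ n * w omega phi))%:E)%E).
  exact: measurable_funeM.
have hge0 omega :
    (0 <= (8 * (2 ^+ n) ^+ 2)%:E * (1 - cos (2^-1 ^+ n * w omega phi))%:E)%E.
  by rewrite mule_ge0// lee_fin mulr_ge0// exprn_ge0// exprn_ge0.
apply: (@le_trans _ _ (\int[P]_(omega in A n)
  ((8 * (2 ^+ n) ^+ 2)%:E * (1 - cos (2^-1 ^+ n * w omega phi))%:E))%E); last first.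
  exact: ge0_subset_integral.
apply: ge0_le_integral => //.
- exact: measurable_funS mX2.
- exact: measurable_funS mh.
move=> omega Aomega; rewrite -EFinM lee_fin powR_mulrn// real_normK ?num_real//.
have /sqr_le_one_subr_cos cosq : `|2^-1 ^+ n * w omega phi| <= 1.
  rewrite normrM gtr0_norm// (le_trans (ler_wpM2l (ltW (h0 n)) Aomega))//.
  by rewrite exprVMn2.
rewrite (_ : w omega phi ^+ 2 = (2 ^+ n) ^+ 2 * (2^-1 ^+ n * w omega phi) ^+ 2).
  apply: le_trans (ler_wpM2l _ cosq) _; first by rewrite exprn_ge0// exprn_ge0.
  by rewrite mulrA [_ * 8]mulrC.
transitivity (w omega phi ^+ 2 * (2^-1 ^+ n * 2 ^+ n) ^+ 2); last by ring.
by rewrite exprVMn2 expr1n mulr1.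
Unshelve. all: by end_near. Qed.

End second_moment.

(** * The moment bounds *)

Theorem theorem2 (R : realType) (d : nat) (d_gt0 : (0 < d)%N)
    (dO : measure_display) (Omega : measurableType dO)
    (P : probability Omega R) (f : R -> R[i])
    (w : {RV P >-> tempered R d}) (w_noise : levy_white_noise f w) :
  (forall p b0 boo : R,
      0 < p -> p < beta_zero f ->
      b0 \in I_zero f -> boo \in I_infty f -> p < b0 -> p < boo ->
      moment_bound w p b0 boo) /\
  (beta_zero f = 2 -> 2 \in I_zero f -> moment_bound w 2 2 2).
Proof.
have [[mu [_ cRe cIm f0 _] _] _] := w_noise; split.
  move=> p b0 boo p0 _ b0_zero boo_infty pb0 pboo.
  have b0_gt0 := lt_trans p0 pb0; have boo_gt0 := lt_trans p0 pboo.
  have [C C0 fC] := levy_size_bound cRe cIm f0 (ltW b0_gt0) b0_zero boo_infty.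
  have [K K0 momentK] := moment_normalized w_noise C0 p0 pb0 pboo fC.
  exact: moment_bound_of_normalized momentK.
move=> _ /(I_zero_bound f0)[K K0 [r r0 fK]].
(* [K] may be 0, whereas the constant of a moment bound is positive. *)
have K24 : 0 < 24 * K + 1 by rewrite ltr_wpDl// mulr_ge0.
apply: (moment_bound_of_normalized K24) => // phi phi1 _.
apply: le_trans (second_moment_le w_noise K0 r0 fK phi1) _.
by rewrite lee_fin mulr1 lerDl.
Qed.
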